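(* Let $\Omega=(a,b)$, let $0<\epsilon\le1$, and let $\mathcal{L}u=-\epsilon^2u''+u$. Then there exists a constant $C_\epsilon>0$, depending on $\epsilon$, such that for every $u\in\mathcal{S}^W(\Omega)$, $$\|u\|_{2,\epsilon,\Omega}^2\le C_\epsilon\,\mathcal{V}_p^W(u),\qquad \mathcal{V}_p^W(u)=\|\mathcal{L}u\|_{L^2(\Omega)}^2+|u(a)|^2+|u(b)|^2,$$ provided $W=O\left(\tfrac1\epsilon\right)$.
   Context: $\Omega=(a,b)$ is a bounded open interval. In this single-element ($p$-version) setting, $\mathcal{S}^W(\Omega)$ is the space of polynomials of degree at most $W$ on $\Omega$, $W\ge1$ an integer. The parameter-dependent norm is $$\|u\|_{2,\epsilon,\Omega}^2=\sum_{j=0}^{2}\epsilon^{2j}\left\|\frac{d^ju}{dx^j}\right\|_{L^2(\Omega)}^2 .$$ The condition $W=O(1/\epsilon)$ is in the usual Landau sense: $W\le c_0/\epsilon$ for a fixed constant $c_0$ (on which $C_\epsilon$ may depend). *)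

(* Defs.v *)
From HB Require Import structures.
From mathcomp Require Import all_boot all_order all_algebra.
From mathcomp Require Import all_classical all_reals all_analysis.

Set Implicit Arguments.
Unset Strict Implicit.
Unset Printing Implicit Defensive.

Import Order.TTheory GRing.Theory Num.Theory.
Import numFieldNormedType.Exports.

Local Open Scope classical_set_scope.
Local Open Scope ring_scope.

(* The norms take values in [\bar R], so that no finiteness is presupposed. *)
Definition L2norm (R : realType) (Om : set R) (f : R -> R) : \bar R :=
  'N[lebesgue_measure]_(2%:E)[(EFin \o f) \_ Om]%E.

(* Elements of S^W are kept as polynomial functions on the whole line; for a
   nonempty open interval this amounts to polynomials on the interval together
   with their continuous extension to the end points. *)
Definition polySpace (R : realType) (W : nat) : set (R -> R) :=
  [set u | exists2 p : {poly R}, (size p <= W.+1)%N & u = horner p].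

Arguments polySpace R W : clear implicits.

Definition norm2eps_sqr (R : realType) (eps : R) (Om : set R) (u : R -> R) :
    \bar R :=
  (\sum_(j < 3) (eps ^+ (2 * j))%:E * L2norm Om (derive1n j u) ^+ 2)%E.

Definition Lop (R : realType) (eps : R) (u : R -> R) : R -> R :=
  fun x => - eps ^+ 2 * derive1n 2 u x + u x.

Definition Vp (R : realType) (eps a b : R) (u : R -> R) : \bar R :=
  (L2norm `]a, b[%classic (Lop eps u) ^+ 2
   + (`|u a| ^+ 2)%:E + (`|u b| ^+ 2)%:E)%E.

(* Main.v *)
Require Import Defs.
From HB Require Import structures.
From mathcomp Require Import all_boot all_order all_algebra.
From mathcomp Require Import all_classical all_reals all_analysis.
From mathcomp Require Import measurable_realfun ring lra.
Import Order.TTheory GRing.Theory Num.Theory.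
Import numFieldNormedType.Exports.
Local Open Scope classical_set_scope.
Local Open Scope ring_scope.

(** Integration by parts gives
    [|Lu|^2 = |u|^2 + 2 eps^2 |u'|^2 + eps^4 |u''|^2 - 2 eps^2 [u u']_a^b].
    By Young's inequality the boundary term is absorbed by the end point values
    of [u] and a small multiple of those of [u'], and the latter are controlled
    by the trace inequality
    [u'(a)^2 + u'(b)^2 <= (2 / (b - a) + 1) (|u'|^2 + |u''|^2)].
    Integrals of polynomials are handled through polynomial antiderivatives, so
    that every integral inequality is the monotonicity of a polynomial whose
    derivative is nonnegative on [[a, b]]. *)

Lemma poly_antiderivative (R : numFieldType) (p : {poly R}) :
  exists P : {poly R}, P^`() = p.
Proof.
(* At [i = 0] the quotient divides by zero and is [0]; differentiation discards that coefficient. *)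
exists (\poly_(i < (size p).+1) (p`_i.-1 / i%:R)).
apply/polyP => i; rewrite coef_deriv coef_poly ltnS /=.
case: ltnP => [_|?]; last by rewrite mul0rn nth_default.
by rewrite -[LHS]mulr_natr divfK// pnatr_eq0.
Qed.

Lemma horner_le_deriv_ge0 (R : realType) (a b : R) (P : {poly R}) :
  a <= b -> (forall x, a <= x <= b -> 0 <= P^`().[x]) -> P.[a] <= P.[b].
Proof.
move=> ab P'0.
have dP x : x \in `]a, b[ -> is_derive x 1 (horner P) (horner P^`() x).
  by move=> _; exact: is_derive_poly.
have cP : {within `[a, b], continuous (horner P)}.
  by apply: continuous_subspaceT => x; exact: continuous_horner.
have [c + e] := MVT_segment ab dP cP.
by rewrite in_itv/= => cab; rewrite -subr_ge0 e mulr_ge0 ?subr_ge0// P'0.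
Qed.

(* [hornerE] also runs an AC normalisation of products, which hides them from
   [ring] and [lra]. *)
Definition horner_morphE := (hornerD, hornerN, hornerZ, hornerM, hornerX,
  hornerC, horner_exp, hornerMn).

Lemma trace_inequality (R : realType) (a b : R) (g P Q : {poly R}) :
  a < b -> P^`() = g ^+ 2 -> Q^`() = g^`() ^+ 2 ->
  g.[a] ^+ 2 + g.[b] ^+ 2 <=
  (2 / (b - a) + 1) * ((P.[b] - P.[a]) + (Q.[b] - Q.[a])).
Proof.
move=> ab P' Q'; have L0 : 0 < b - a by rewrite subr_gt0.
pose k := 2 / (b - a); have k0 : 0 < k by rewrite divr_gt0.
have kL : k * (b - a) = 2 by rewrite divfK// gt_eqF.
(* An affine weight with [q.[a] = -1] and [q.[b] = 1]. *)
pose q : {poly R} := k *: 'X - (k * a + 1)%:P.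
pose G := (k + 1) *: (P + Q) - q * g ^+ 2.
have G' : G^`() =
    (k + 1) *: (g ^+ 2 + g^`() ^+ 2) - (k *: g ^+ 2 + q * (g^`() * g *+ 2)).
  rewrite derivB derivZ derivD P' Q' derivM /q derivB derivZ derivX derivC subr0.
  by rewrite alg_polyC mul_polyC expr2 derivM; congr (_ - (_ + _ * _)); ring.
have G'0 x : a <= x <= b -> 0 <= G^`().[x].
  move=> /andP[ax xb]; rewrite G' /q !horner_morphE.
  set s := k * x - _; set y := g.[x]; set z := g^`().[x].
  have sa : 1 + s = k * (x - a) by rewrite /s; ring.
  have sb : 1 - s = k * (b - x) by rewrite /s; lra.
  have s1 : s ^+ 2 <= 1.
    rewrite -subr_ge0 -[X in X - _](expr1n _ 2) subr_sqr sa sb.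
    by apply: mulr_ge0; rewrite pmulr_rge0 ?subr_ge0.
  have -> : (k + 1) * (y ^+ 2 + z ^+ 2) - (k * y ^+ 2 + s * (z * y *+ 2)) =
    (y - s * z) ^+ 2 + (k + (1 - s ^+ 2)) * z ^+ 2 by ring.
  by rewrite addr_ge0 ?sqr_ge0// mulr_ge0 ?sqr_ge0// addr_ge0 ?subr_ge0// ltW.
have := horner_le_deriv_ge0 _ _ _ _ (ltW ab) G'0.
rewrite -/k /G /q !horner_morphE.
have -> : k * b - (k * a + 1) = 1 by lra.
have -> : k * a - (k * a + 1) = - 1 by lra.
by lra.
Qed.

Lemma energy_estimate (R : realType) (a b eps : R) (u A B D F : {poly R}) :
  a < b -> 0 < eps -> eps <= 1 ->
  A^`() = u ^+ 2 -> B^`() = u^`() ^+ 2 -> D^`() = u^`()^`() ^+ 2 ->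
  F^`() = (- eps ^+ 2 *: u^`()^`() + u) ^+ 2 ->
  (A.[b] - A.[a]) + eps ^+ 2 * (B.[b] - B.[a]) + eps ^+ 4 * (D.[b] - D.[a]) <=
  4 * (2 / (b - a) + 1) *
  ((F.[b] - F.[a]) + u.[a] ^+ 2 + u.[b] ^+ 2).
Proof.
move=> ab e0 e1 A' B' D' F'.
have trace := trace_inequality _ _ _ _ _ _ ab B' D'.
set K := 2 / (b - a) + 1 in trace *.
have K1 : 1 <= K by rewrite lerDr divr_ge0// subr_ge0 ltW.
have K0 : 0 < K by rewrite (lt_le_trans ltr01).
pose e2 := eps ^+ 2.
have e4E : eps ^+ 4 = e2 ^+ 2 by rewrite -exprM.
have e20 : 0 < e2 by rewrite exprn_gt0.
have e21 : e2 <= 1 by rewrite exprn_ile1// ltW.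
have nonneg (P p : {poly R}) : P^`() = p ^+ 2 -> 0 <= P.[b] - P.[a].
  move=> P'; rewrite subr_ge0 horner_le_deriv_ge0 ?ltW// => x _.
  by rewrite P' horner_exp sqr_ge0.
(* The derivative of [G] vanishes identically: this is the integration by parts identity, from which
   the direction [G.[a] <= G.[b]] is extracted. *)
pose G := F - A - (2 * e2) *: B - e2 ^+ 2 *: D + (2 * e2) *: (u * u^`()).
have G'0 x : a <= x <= b -> 0 <= G^`().[x].
  rewrite /G !(derivD, derivN, derivZ, derivM, A', B', D', F') -/e2.
  rewrite !horner_morphE => _; rewrite le_eqVlt; apply/orP; left; apply/eqP.
  by ring.
have := horner_le_deriv_ge0 _ _ _ _ (ltW ab) G'0.
rewrite {G'0}/G !horner_morphE e4E -/e2 => parts.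
pose w := e2 ^+ 2 / (2 * K).
have wK : w * K = e2 ^+ 2 / 2 by rewrite /w; field; rewrite gt_eqF.
have w0 : 0 <= w by rewrite divr_ge0 ?sqr_ge0// mulr_ge0// ltW.
(* Young's inequality; the weight [w] is such that the trace inequality turns
   the [u'] terms into at most half of the energy. *)
have young (y z s : R) : s ^+ 2 = 1 ->
    2 * e2 * (s * (y * z)) <= 2 * K * y ^+ 2 + w * z ^+ 2.
  move=> s1; rewrite -subr_ge0.
  have -> : 2 * K * y ^+ 2 + w * z ^+ 2 - 2 * e2 * (s * (y * z)) =
      (2 * K * y - s * e2 * z) ^+ 2 / (2 * K) + (1 - s ^+ 2) * (w * z ^+ 2).
    by rewrite /w; field; rewrite gt_eqF.
  rewrite s1 subrr mul0r addr0 divr_ge0 ?sqr_ge0//.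
  by rewrite mulr_ge0// ltW.
have youngb := young u.[b] u^`().[b] 1 (expr1n _ _).
(* The sign [-1] matches the lower end of the boundary term. *)
have younga := young u.[a] u^`().[a] (-1) (etrans (sqrrN 1) (expr1n _ _)).
have := ler_wpM2l w0 trace; rewrite mulrA wK => traceE.
have A0 := nonneg _ _ A'; have B0 := nonneg _ _ B'; have F0 := nonneg _ _ F'.
(* The trace inequality produces [e2 ^+ 2] in front of the [u'] integral, whereas the energy carries
   [e2]; [eps <= 1] closes the gap. *)
have B1 : e2 ^+ 2 * (B.[b] - B.[a]) <= e2 * (B.[b] - B.[a]).
  by rewrite ler_wpM2r// expr2 ler_piMl// ltW.
have F1 : F.[b] - F.[a] <= K * (F.[b] - F.[a]) by rewrite ler_peMl.
have eB : 0 <= e2 * (B.[b] - B.[a]) by rewrite mulr_ge0// ltW.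
(* Half of the [u''] term survives the absorption; doubling to restore it turns Young's [2 * K] into
   [4 * K]. *)
by clear -parts youngb younga traceE B1 F1 A0 F0 eB; lra.
Qed.

Lemma integral_horner_deriv (R : realType) (a b : R) (P : {poly R}) : a < b ->
  (\int[lebesgue_measure]_(x in `]a, b[) (P^`().[x])%:E = (P.[b] - P.[a])%:E)%E.
Proof.
(* The end points, a null set, are added in order to apply the fundamental theorem on the closed
   interval. *)
move=> ab; rewrite -(@integral_itv_bndoo _ _ _ _ true false); last first.
  apply/measurable_EFinP; apply: measurable_funTS.
  by apply: continuous_measurable_fun; exact: continuous_horner.
rewrite (@continuous_FTC2 _ _ (horner P))//.
- by apply: continuous_subspaceT => x; exact: continuous_horner.
- split=> [x _||]; first exact: derivable_horner.
  + by apply: cvg_at_right_filter; exact: continuous_horner.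
  + by apply: cvg_at_left_filter; exact: continuous_horner.
- by move=> x _; rewrite derivE.
Qed.

(** Bridges the real exponent inside the Lebesgue norm and the natural powers in [norm2eps_sqr] and
    [Vp]. *)
Lemma poweR_sqr (R : realType) (x : \bar R) : (0 <= x -> x `^ 2 = x ^+ 2)%E.
Proof.
case: x => [x x0||//]; first by rewrite poweR_EFin powR_mulrn.
by rewrite poweRyr ?pnatr_eq0// expe2 mulyy.
Qed.

Lemma L2norm_sqr_horner (R : realType) (a b : R) (p P : {poly R}) :
  a < b -> P^`() = p ^+ 2 ->
  (L2norm `]a, b[%classic (horner p) ^+ 2 = (P.[b] - P.[a])%:E)%E.
Proof.
move=> ab P'; rewrite /L2norm -poweR_sqr ?Lnorm_ge0// poweR_Lnorm ?pnatr_eq0//.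
rewrite -integral_horner_deriv// [RHS]integral_mkcond; apply: eq_integral => x _.
rewrite /patch; case: ifPn => _; last by rewrite abse0 poweR0r ?pnatr_eq0.
rewrite poweR_sqr ?abse_ge0// P' horner_exp.
by rewrite -[(_ \o _) x]/(p.[x]%:E) abse_EFin -EFin_expe real_normK ?num_real.
Qed.

Theorem theorem3p1 (R : realType) (a b : R) (hab : a < b)
    (eps : R) (heps0 : 0 < eps) (heps1 : eps <= 1)
    (c0 : R) (hc0 : 0 < c0) :
  exists2 C : R, 0 < C &
    forall W : nat, (1 <= W)%N -> W%:R <= c0 / eps ->
    forall u : R -> R, u \in polySpace R W ->
      (norm2eps_sqr eps `]a, b[%classic u <= C%:E * Vp eps a b u)%E.
Proof.
pose K := 4 * (2 / (b - a) + 1).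
have K0 : 0 < K by rewrite mulr_gt0// ltr_wpDl// divr_ge0// subr_ge0 ltW.
exists K => // W _ _ u /set_mem[p _ ->].
have d1 : derive1n 1 (horner p) = horner p^`() by rewrite derivE.
have d2 : derive1n 2 (horner p) = horner p^`()^`() by rewrite !derivE.
pose f := - eps ^+ 2 *: p^`()^`() + p.
have Lf : Lop eps (horner p) = horner f.
  by apply/funext => x; rewrite /Lop d2 /f !hornerE.
have [A A'] := poly_antiderivative _ (p ^+ 2).
have [B B'] := poly_antiderivative _ (p^`() ^+ 2).
have [D D'] := poly_antiderivative _ (p^`()^`() ^+ 2).
have [F F'] := poly_antiderivative _ (f ^+ 2).
have estimate := energy_estimate _ _ _ _ _ _ _ _ _ hab heps0 heps1 A' B' D' F'.
have -> : norm2eps_sqr eps `]a, b[%classic (horner p) =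
    ((A.[b] - A.[a])%:E + (eps ^+ 2)%:E * (B.[b] - B.[a])%:E
     + (eps ^+ 4)%:E * (D.[b] - D.[a])%:E)%E.
  rewrite -(L2norm_sqr_horner _ _ _ _ _ hab A').
  rewrite -(L2norm_sqr_horner _ _ _ _ _ hab B').
  rewrite -(L2norm_sqr_horner _ _ _ _ _ hab D') -d1 -d2.
  by rewrite /norm2eps_sqr !big_ord_recl big_ord0 adde0 expr0 mul1e addeA.
rewrite /Vp Lf (L2norm_sqr_horner _ _ _ _ _ hab F') -!EFinM -!EFinD lee_fin.
by rewrite !real_normK ?num_real.
Qed.
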